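(* Under conditions (C1) and (C2), the singular locus of the left ideal $\mathfrak I=D_m\ell_1+\cdots+D_m\ell_m$ (i.e. of the system $\mathcal F_C^{p,m}(a,B)$) is $$S(x)=\{x\in\mathbb C^m\mid x_1\cdots x_m R(x)=0\},$$ where $R(x)=\prod_{(i_1,\dots,i_m)\in\{1,\dots,p\}^m}\big(1-\zeta_p^{i_1}\sqrt[p]{x_1}-\cdots-\zeta_p^{i_m}\sqrt[p]{x_m}\big)$, a polynomial in $x_1,\dots,x_m$ of degree $p^{m-1}$, with $\zeta_p=\exp(2\pi\sqrt{-1}/p)$.
   Context: $D_m=\mathbb C\langle x_1,\dots,x_m,\partial_1,\dots,\partial_m\rangle$ is the Weyl algebra. For $a_1,\dots,a_p\in\mathbb C$, $b_{j,k}\in\mathbb C\setminus\{0,-1,-2,\dots\}$ ($1\le j\le p-1$), $b_{p,k}=1$, let $\ell_k=\prod_{i=1}^p(x_k\partial_k+b_{i,k}-1)-x_k\prod_{i=1}^p(\sum_{j=1}^m x_j\partial_j+a_i)$, $k=1,\dots,m$. Conditions: (C1) $a_i-\sum_{k=1}^m b_{j_k,k}\notin\mathbb Z$ for all $i$ and all $(j_1,\dots,j_m)\in\{1,\dots,p\}^m$; (C2) $b_{j,k}-b_{j',k}\notin\mathbb Z$ for $1\le j<j'\le p$. The initial ideal $\operatorname{in}(\mathfrak I)\subset\mathbb C[x,\xi]$ is the ideal of principal symbols (w.r.t. order filtration) of elements of $\mathfrak I$; the characteristic variety is $\operatorname{Ch}(\mathfrak I)=\{(x,\xi)\in\mathbb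 C^{2m}\mid L(x,\xi)=0\ \forall L\in\operatorname{in}(\mathfrak I)\}$; the singular locus is the Zariski closure of the projection to $x$-space of $\operatorname{Ch}(\mathfrak I)\setminus\{\xi=0\}$. *)

(* Defs.v *)
From HB Require Import structures.
From mathcomp Require Import all_boot all_algebra.
From mathcomp Require Import mpoly.
From mathcomp Require Import complex.
From mathcomp Require Import Rstruct.
From Stdlib Require Rdefinitions Rtrigo_def Rtrigo1.

Set Implicit Arguments.
Unset Strict Implicit.
Unset Printing Implicit Defensive.
Import GRing.Theory Num.Theory.
Local Open Scope ring_scope.

Definition CC : Type := complex Rdefinitions.R.

Definition zeta (p : nat) : CC :=
  Complex (Rtrigo_def.cos (2%:R * Rtrigo1.PI / p%:R))
          (Rtrigo_def.sin (2%:R * Rtrigo1.PI / p%:R)).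

Definition isInt (z : CC) : Prop := exists n : int, z = n%:~R.

(** The Weyl algebra D_m.  An element is written uniquely in normal order
    sum c_{al,be} x^al d^be ; we store it as the commutative polynomial
    sum c_{al,be} X^al Xi^be in 2m variables: variable [lshift m i] is x_i,
    variable [rshift m i] is d_i (resp. xi_i for symbols). *)
Definition Weyl (m : nat) := {mpoly CC[m + m]}.

Definition wx (m : nat) (i : 'I_m) : Weyl m := 'X_(lshift m i).
Definition wd (m : nat) (i : 'I_m) : Weyl m := 'X_(rshift m i).
Definition wc (m : nat) (c : CC) : Weyl m := c%:MP.

(** Product of the normally ordered monomials
    (x^al d^be) * (x^ga d^de)
      = x^al * prod_i (sum_k binom(be_i,k) ga_i^(k falling) x_i^(ga_i-k) d_i^(be_i-k)) * d^de
    (Leibniz rule d^b x^c = sum_k C(b,k) c(c-1)..(c-k+1) x^(c-k) d^(b-k)). *)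
Definition weyl_mono (m : nat) (s t : 'X_{1..m + m}) : Weyl m :=
  (\prod_(i < m) 'X_(lshift m i) ^+ s (lshift m i))
  * (\prod_(i < m) \sum_(k < (s (rshift m i)).+1)
        (('C(s (rshift m i), k) * (t (lshift m i)) ^_ k)%N%:R : CC) *:
        ('X_(lshift m i) ^+ (t (lshift m i) - k)%N
           * 'X_(rshift m i) ^+ (s (rshift m i) - k)%N))
  * (\prod_(i < m) 'X_(rshift m i) ^+ t (rshift m i)).

Definition weyl_mul (m : nat) (P Q : Weyl m) : Weyl m :=
  \sum_(s <- msupp P) \sum_(t <- msupp Q)
     (P@_s * Q@_t) *: weyl_mono s t.

Definition theta (m : nat) : Weyl m := \sum_(j < m) weyl_mul (wx j) (wd j).

Definition ell (m p : nat) (a : 'I_p -> CC) (b : 'I_p -> 'I_m -> CC)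
    (k : 'I_m) : Weyl m :=
  \big[@weyl_mul m/1]_(i < p) (weyl_mul (wx k) (wd k) + wc m (b i k - 1))
  - weyl_mul (wx k) (\big[@weyl_mul m/1]_(i < p) (theta m + wc m (a i))).

Definition in_ideal (m p : nat) (a : 'I_p -> CC) (b : 'I_p -> 'I_m -> CC)
    (P : Weyl m) : Prop :=
  exists Q : 'I_m -> Weyl m, P = \sum_(k < m) weyl_mul (Q k) (ell a b k).

Definition dorder_mono (m : nat) (s : 'X_{1..m + m}) : nat :=
  (\sum_(i < m) s (rshift m i))%N.
Definition dorder (m : nat) (P : Weyl m) : nat :=
  (\max_(s <- msupp P) dorder_mono s)%N.

Definition psymb (m : nat) (P : Weyl m) : {mpoly CC[m + m]} :=
  \sum_(s <- msupp P | dorder_mono s == dorder P) P@_s *: 'X_[s].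

(** Characteristic variety: common zeros of in(I) (the principal symbols of
    elements of I) in C^{2m}; a point is v with x_i = v (lshift m i) and
    xi_i = v (rshift m i). *)
Definition charvar (m p : nat) (a : 'I_p -> CC) (b : 'I_p -> 'I_m -> CC)
    (v : 'I_(m + m) -> CC) : Prop :=
  forall P : Weyl m, in_ideal a b P -> (psymb P).@[v] = 0.

Definition proj_charvar (m p : nat) (a : 'I_p -> CC) (b : 'I_p -> 'I_m -> CC)
    (x : 'I_m -> CC) : Prop :=
  exists v : 'I_(m + m) -> CC,
    [/\ charvar a b v, (exists i : 'I_m, v (rshift m i) != 0)
      & forall i : 'I_m, x i = v (lshift m i)].

Definition zariski_closure (m : nat) (S : ('I_m -> CC) -> Prop)
    (x : 'I_m -> CC) : Prop :=
  forall f : {mpoly CC[m]}, (forall y, S y -> f.@[y] = 0) -> f.@[x] = 0.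

Definition sing_locus (m p : nat) (a : 'I_p -> CC) (b : 'I_p -> 'I_m -> CC)
    : ('I_m -> CC) -> Prop :=
  zariski_closure (proj_charvar a b).

(** R(x) = prod_{(i_1..i_m) in {1..p}^m} (1 - sum_k zeta_p^{i_k} x_k^{1/p}),
    with x_k^{1/p} a (fixed) p-th root of x_k (the product does not depend on
    the choice); the index i_k in {1..p} is encoded by j : 'I_p, i_k = j+1. *)
Definition Rfun (m p : nat) (x : 'I_m -> CC) : CC :=
  \prod_(f : {ffun 'I_m -> 'I_p})
     (1 - \sum_(k < m) zeta p ^+ (f k).+1 * p.-root (x k)).

(* Main.v *)
Require Import Defs.
From HB Require Import structures.
From mathcomp Require Import all_boot all_order all_algebra.
From mathcomp Require Import mpoly ssrcomplements.
From mathcomp Require Import complex.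
From mathcomp Require Import Rstruct.
From mathcomp Require Import ring zify.
From Stdlib Require Rdefinitions Rtrigo_def Rtrigo1.
Import Order.TTheory GRing.Theory Num.Theory.
Local Open Scope ring_scope.

(** The characteristic variety is bounded from above by the symbols
    (x_k xi_k)^p - x_k (sum_j x_j xi_j)^p of the generators: where all x_k are
    nonzero and xi is not, they force w_k = x_k xi_k = zeta^(i_k) x_k^(1/p) S
    with S = sum_k w_k nonzero, hence R(x) = 0.

    For the converse, let F = sum_(n in N^m) A(n) x^n be the hypergeometric
    series, multiplied by the Heaviside functions of all the x_k.  Every P in
    the ideal annihilates F, and this single solution detects every component.
    - x_k = 0: the coefficient of P F at the most singular power of delta(x_k)
      shows that the symbol of P vanishes at (x, e_k).
    - R = 0: the coefficient of P F at x^(M+j), divided by A(j), is up to a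
      known denominator a polynomial in j that vanishes on N^m, hence
      identically.  Since A(j - e_k) / A(j) behaves like j_k^p / (sum_i j_i)^p,
      its top homogeneous part at j = w is, up to a nonzero factor, the symbol
      of P at x_k = w_k^p / S^p, xi_k = w_k / x_k.
    Condition (C1) is what makes A(j) nonzero. *)

(** * Linear functionals prescribed on monomials *)

Lemma mcoeff_sum_supp n (K : comNzRingType) (P : {mpoly K[n]}) (c : 'X_{1..n} -> K) t :
  (\sum_(s <- msupp P) c s *: 'X_[s])@_t = if t \in msupp P then c t else 0.
Proof.
rewrite raddf_sum /=; under eq_bigr => s _ do rewrite mcoeffZ mcoeffX.
case: ifPn => tP; last first.
  rewrite big1_seq // => s /andP[_ sP].
  by have [st|_] := eqVneq s t; [rewrite -st sP in tP | rewrite mulr0].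
rewrite (bigD1_seq t) ?msupp_uniq //= eqxx mulr1 big1 ?addr0 // => s /negbTE ->.
by rewrite mulr0.
Qed.

Section LinearExtension.
Variables (n : nat) (K : comNzRingType).
Implicit Types (g : 'X_{1..n} -> K) (P : {mpoly K[n]}).

Definition mlin g P : K := \sum_(s <- msupp P) P@_s * g s.

(** Replaces the support of [P] by a range of monomials independent of [P], so that linearity
    becomes a termwise identity. *)
Lemma mlin_wE g P k : (msize P <= k)%N ->
  mlin g P = \sum_(s : 'X_{1..n < k}) P@_s * g s.
Proof.
move=> le_Pk; rewrite /mlin (big_mksub ('X_{1..n < k} : subFinType _)) //=; first last.
- by move=> s /msize_mdeg_lt /leq_trans; apply.
- exact: msupp_uniq.
by rewrite big_rmcond //= => s; move/memN_msupp_eq0 ->; rewrite mul0r.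
Qed.

Lemma mlin_is_linear g : linear_for *%R (mlin g).
Proof.
move=> c P Q; set k := maxn (msize (c *: P + Q)) (maxn (msize P) (msize Q)).
rewrite !(@mlin_wE g _ k) ?leq_max ?leqnn ?orbT //.
rewrite mulr_sumr -big_split /=; apply: eq_bigr => s _.
by rewrite mcoeffD mcoeffZ mulrDl mulrA.
Qed.

HB.instance Definition _ g :=
  GRing.isLinear.Build K {mpoly K[n]} K *%R (mlin g) (mlin_is_linear g).

Lemma mlinX g s : mlin g 'X_[s] = g s.
Proof. by rewrite /mlin msuppX big_seq1 mcoeffX eqxx mul1r. Qed.

End LinearExtension.

(** * Differentiation and multiplication in one variable *)

(* One-variable weights on the basis indexed by n : int that stands for H x^n
   (n >= 0, H the Heaviside function) and for delta^(-n-1) up to sign and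
   factorials (n < 0): here d/dx H = delta and x delta = 0. *)
Section HeavisideBasis.
Variable K : numFieldType.

(** Coefficient of index [n] in the derivative of the basis element of index [n + 1]. The value 1 at
    [n = -1] is the rule d/dx H = delta; hence these weights never vanish. *)
Definition hwt (n : int) : K := if n == -1 then 1 else (n + 1)%:~R.

Fixpoint hd (g : nat) (n : int) : K := if g is g'.+1 then hwt n * hd g' (n + 1) else 1.

(** Coefficient of index [n] in x^a times the basis element of index [n - a]. The factor at 0
    encodes x delta = 0. *)
Fixpoint hx (a : nat) (n : int) : K := if a is a'.+1 then (n != 0)%:R * hx a' (n - 1) else 1.

Definition hk (a g : nat) (n : int) : K := hx a n * hd g (n - a%:Z).

Lemma hx_add a b n : hx (a + b) n = hx a n * hx b (n - a%:Z).
Proof.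
elim: a n => [|a IH] n /=; first by rewrite subr0 mul1r.
rewrite IH mulrA; congr (_ * hx b _); lia.
Qed.

Lemma hd_add a b n : hd (a + b) n = hd a n * hd b (n + a%:Z).
Proof.
elim: a n => [|a IH] n /=; first by rewrite addr0 mul1r.
rewrite IH mulrA; congr (_ * hd b _); lia.
Qed.

Lemma hxSr b n : hx b.+1 n = hx b n * (n != b%:Z)%:R.
Proof. by rewrite -addn1 hx_add /= mulr1 subr_eq0. Qed.

(** The commutation rule d x^b = x^b d + b x^(b-1), read at index [n]; only [n = -1] and [n = b]
    differ from the usual computation with powers. *)
Lemma hwt_hx b n : hwt n * hx b (n + 1) = hx b n * hwt (n - b%:Z) + b%:R * hx b.-1 n.
Proof.
case: b => [|b]; first by rewrite /= subr0 mul0r addr0 mulrC.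
rewrite [in RHS]hxSr /= addrK /hwt.
have -> : (n - b.+1%:Z == -1) = (n == b%:Z) by apply/eqP/eqP; lia.
have -> : (n + 1 != 0) = (n != -1) by congr (~~ _); apply/eqP/eqP; lia.
have -> : n - b.+1%:Z + 1 = n - b%:Z by lia.
rewrite rmorphB rmorphD /= -pmulrn -[b.+1]addn1 natrD.
case: (eqVneq n (-1)) => [->|_].
  have -> : (-1 == b%:Z :> int) = false by apply/eqP; lia.
  by rewrite /=; ring.
by case: (eqVneq n b%:Z) => [->|_] /=; ring.
Qed.

(** Leibniz rule for d^g x^a, by induction on [g]. The bound [N] is free so that all coordinates can
    later share one index set; the extra binomials are zero. *)
Lemma hd_hx g a n N : (g < N)%N ->
  hd g n * hx a (n + g%:Z) = \sum_(k < N) ('C(g, k) * a ^_ k)%N%:R * hk (a - k) (g - k) n.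
Proof.
elim: g a n N => [|g IH] a n [//|N] lt_gN.
  rewrite big_ord_recl big1 /=; last by move=> i _; rewrite bin0n mul0n mul0r.
  by rewrite bin0 ffactn0 mul1r /hk /= addr0 subn0 mulr1 mul1r addr0.
have -> : n + g.+1%:Z = (n + 1) + g%:Z by lia.
rewrite /= -mulrA (IH _ _ N) // mulr_sumr.
(* The additional derivative either moves past the power of x ([G]) or lowers that power ([H]);
   after a shift of [H] by one, Pascal's rule merges the two sums. *)
pose G k := ('C(g, k) * a ^_ k)%N%:R * hk (a - k) (g.+1 - k) n.
pose H k := ('C(g, k) * a ^_ k.+1)%N%:R * hk (a - k.+1) (g - k) n.
transitivity (\sum_(k < N) (G k + H k)).
  apply: eq_bigr => k _; rewrite /G /H.
  case: (leqP k g) => [le_kg|lt_gk]; last by rewrite bin_small // !mul0n !mul0r mulr0 addr0.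
  rewrite /hk mulrCA [hwt n * _]mulrA hwt_hx mulrDl mulrDr.
  rewrite subSn //= -[(a - k).-1]subnS; congr (_ + _).
    by rewrite !mulrA; congr (_ * hwt _ * hd _ _); lia.
  rewrite ffactnSr mulnA !natrM.
  case: (ltnP k a) => [lt_ka|le_ak]; last first.
    have -> : (a - k = 0)%N by (apply/eqP; rewrite subn_eq0).
    by rewrite !(mul0r, mulr0).
  have -> : n + 1 - (a - k)%N%:Z = n - (a - k.+1)%N%:Z by lia.
  by rewrite !mulrA.
rewrite big_split /= [X in _ + X](_ : _ = \sum_(k < N.+1) ('C(g, k.-1) * a ^_ k)%N%:R *+ (0 < k)%N * hk (a - k) (g.+1 - k) n); last first.
  by rewrite big_ord_recl /= mulr0n mul0r add0r; apply: eq_bigr => k _; rewrite /bump /= /H subSS.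
rewrite [X in X + _](_ : _ = \sum_(k < N.+1) G k); last first.
  by rewrite big_ord_recr /= [G N](_ : _ = 0) ?addr0 // /G bin_small // mul0n mul0r.
rewrite -big_split /=; apply: eq_bigr => -[[|k] lt_k] _ /=; rewrite /G -mulrDl.
  by rewrite mulr0n addr0 !bin0.
by rewrite mulr1n -natrD -mulnDl binS.
Qed.

Lemma hk_mul a g a' g' n N : (g < N)%N ->
  hk a g n * hk a' g' (n - a%:Z + g%:Z) =
  \sum_(k < N) ('C(g, k) * a' ^_ k)%N%:R * hk (a + (a' - k)) (g - k + g') n.
Proof.
move=> lt_gN; rewrite /hk.
transitivity (hx a n * (hd g (n - a%:Z) * hx a' (n - a%:Z + g%:Z))
              * hd g' (n - a%:Z + g%:Z - a'%:Z)); first by ring.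
rewrite (@hd_hx g a' _ N) // mulr_sumr mulr_suml; apply: eq_bigr => k _.
case: (leqP k g) => [le_kg|lt_gk]; last by rewrite bin_small // !mul0n !(mul0r, mulr0).
case: (leqP k a') => [le_ka|lt_ak]; last by rewrite ffact_small // !muln0 !(mul0r, mulr0).
rewrite hx_add hd_add /hk.
have -> : n - a%:Z - (a' - k)%N%:Z = n - (a + (a' - k))%N%:Z by lia.
have -> : n - (a + (a' - k))%N%:Z + (g - k)%N%:Z = n - a%:Z + g%:Z - a'%:Z by lia.
by ring.
Qed.

End HeavisideBasis.

(** * Action of the Weyl algebra on Heaviside series *)

Lemma mpolyX_split m (K : comNzRingType) (s : 'X_{1..m + m}) :
  'X_[s] = (\prod_(i < m) 'X_(lshift m i) ^+ s (lshift m i))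
           * (\prod_(i < m) 'X_(rshift m i) ^+ s (rshift m i)) :> {mpoly K[m + m]}.
Proof. by rewrite mpolyXE_id big_split_ord. Qed.

(* The normally ordered monomial of the Leibniz expansion in which f i
   derivatives hit the factor x_i^(t_i). *)
Definition leibniz_mnm m (s t : 'X_{1..m + m}) (f : 'I_m -> nat) : 'X_{1..m + m} :=
  [multinom match split i with
            | inl j => s (lshift m j) + (t (lshift m j) - f j)
            | inr j => s (rshift m j) - f j + t (rshift m j)
            end%N | i < m + m].

Lemma leibniz_mnml m s t f j :
  leibniz_mnm m s t f (lshift m j) = (s (lshift m j) + (t (lshift m j) - f j))%N.
Proof. by rewrite mnmE -[lshift m j]/(unsplit (inl j)) unsplitK. Qed.

Lemma leibniz_mnmr m s t f j :
  leibniz_mnm m s t f (rshift m j) = (s (rshift m j) - f j + t (rshift m j))%N.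
Proof. by rewrite mnmE -[rshift m j]/(unsplit (inr j)) unsplitK. Qed.

(** Distributes the product over coordinates: a function [f] picks one Leibniz term in each of
    them. *)
Lemma weyl_monoE m (s t : 'X_{1..m + m}) N : (forall i, s (rshift m i) < N)%N ->
  weyl_mono s t = \sum_(f : {ffun 'I_m -> 'I_N})
    (\prod_(i < m) (('C(s (rshift m i), f i) * t (lshift m i) ^_ f i)%N%:R : CC))
      *: 'X_[leibniz_mnm m s t (fun i => f i)].
Proof.
move=> ltN; rewrite /weyl_mono.
under [X in _ * X * _]eq_bigr => i _.
  rewrite (big_ord_widen N (fun k : nat =>
     (('C(s (rshift m i), k) * t (lshift m i) ^_ k)%:R : CC) *:
     ('X_(lshift m i) ^+ (t (lshift m i) - k) * 'X_(rshift m i) ^+ (s (rshift m i) - k)))) //.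
  rewrite big_rmcond /=; last first.
    by move=> k; rewrite ltnS -ltnNge => h; rewrite bin_small // mul0n scale0r.
  over.
rewrite bigA_distr_bigA /= mulr_sumr mulr_suml; apply: eq_bigr => f _.
rewrite scaler_prod -scalerAr -scalerAl; congr (_ *: _).
rewrite mpolyX_split big_split /= !mulrA -big_split /= -mulrA -big_split /=.
by congr (_ * _); apply: eq_bigr => i _; rewrite -exprD ?leibniz_mnml ?leibniz_mnmr.
Qed.

Section HeavisideModule.
Variable m : nat.
Implicit Types (s t : 'X_{1..m + m}) (n : {ffun 'I_m -> int}) (P Q : Weyl m)
  (c : {ffun 'I_m -> int} -> CC).

Definition mono_coef s n : CC := \prod_(i < m) hk _ (s (lshift m i)) (s (rshift m i)) (n i).

Definition mono_shift s n : {ffun 'I_m -> int} :=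
  [ffun i => n i - (s (lshift m i))%:Z + (s (rshift m i))%:Z].

(* The action of the Weyl algebra on formal sums over Z^m in the basis above;
   c n is the coefficient of the basis element of index n. *)
Definition rho P c n : CC := mlin _ _ (fun s => mono_coef s n * c (mono_shift s n)) P.

Lemma rho_sum (I : Type) (r : seq I) (p : pred I) (F : I -> Weyl m) c n :
  rho (\sum_(i <- r | p i) F i) c n = \sum_(i <- r | p i) rho (F i) c n.
Proof. exact: linear_sum. Qed.

Lemma rhoD P Q c n : rho (P + Q) c n = rho P c n + rho Q c n.
Proof. exact: linearD. Qed.

Lemma rhoB P Q c n : rho (P - Q) c n = rho P c n - rho Q c n.
Proof. exact: linearB. Qed.

Lemma rhoZ z P c n : rho (z *: P) c n = z * rho P c n.
Proof. exact: linearZ. Qed.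

Lemma eq_rho P c c' n : c =1 c' -> rho P c n = rho P c' n.
Proof. by move=> e; rewrite /rho /mlin; apply: eq_bigr => s _; rewrite e. Qed.

Lemma rhoX s c n : rho 'X_[s] c n = mono_coef s n * c (mono_shift s n).
Proof. exact: mlinX. Qed.

(** The coordinates act independently, so this is the one-variable product rule in each of them,
    distributed over the choices [f]. *)
Lemma rho_weyl_mono s t c n :
  rho (weyl_mono s t) c n =
  mono_coef s n * mono_coef t (mono_shift s n) * c (mono_shift t (mono_shift s n)).
Proof.
pose N := (mdeg s).+1.
have ltN i : (s (rshift m i) < N)%N.
  by rewrite ltnS mdegE (bigD1 (rshift m i)) //= leq_addr.
rewrite (weyl_monoE _ s t _ ltN) rho_sum.
rewrite /mono_coef -big_split /=.
under [in RHS]eq_bigr => i _ do rewrite ffunE (hk_mul _ _ _ _ _ _ _ (ltN i)).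
rewrite bigA_distr_bigA /= mulr_suml; apply: eq_bigr => f _.
rewrite rhoZ rhoX big_split /= -mulrA.
(* The truncated subtractions in [leibniz_mnm] are genuine for these [f]; for all others the
   binomial or the falling factorial is zero. *)
case: (boolP [forall i, (f i <= s (rshift m i)) && (f i <= t (lshift m i))]%N).
  move=> /forallP le_f; congr (_ * (_ * c _)).
    by apply: eq_bigr => i _; rewrite leibniz_mnml leibniz_mnmr.
  apply/ffunP => i; rewrite !ffunE leibniz_mnml leibniz_mnmr.
  by have /andP[? ?] := le_f i; lia.
rewrite negb_forall; case/existsP => i; rewrite negb_and -!ltnNge => lt_f.
have -> : \prod_(i < m) (('C(s (rshift m i), f i) * t (lshift m i) ^_ f i)%:R : CC) = 0.
  apply/eqP; rewrite prodf_seq_eq0; apply/hasP; exists i; rewrite ?mem_index_enum //=.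
  rewrite pnatr_eq0; case/orP: lt_f => lt_f; first by rewrite bin_small.
  by rewrite ffact_small // muln0.
by rewrite !mul0r.
Qed.

(** [rho] turns products into compositions. An element of the left ideal therefore kills whatever
    the generators kill. *)
Lemma rho_mul P Q c n : rho (weyl_mul P Q) c n = rho P (rho Q c) n.
Proof.
rewrite /weyl_mul rho_sum [RHS]/rho /mlin; apply: eq_bigr => s _.
rewrite rho_sum [rho Q _ _]/rho /mlin !mulr_sumr.
apply: eq_bigr => t _; rewrite rhoZ rho_weyl_mono; ring.
Qed.

Lemma rho1 c n : rho 1 c n = c n.
Proof.
rewrite -[1]mpolyX0 rhoX [mono_coef _ _]big1; last first.
  by move=> i _; rewrite !mnm0E /hk /= mulr1.
by rewrite mul1r; congr c; apply/ffunP => i; rewrite ffunE !mnm0E subr0 addr0.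
Qed.

Lemma rho_wc z c n : rho (wc m z) c n = z * c n.
Proof. by rewrite /wc -[z%:MP]mulr1 mul_mpolyC rhoZ rho1. Qed.

Definition dec_at k n : {ffun 'I_m -> int} := [ffun i => n i - (i == k)%:Z].

Lemma rho_wx k c n : rho (wx k) c n = (n k != 0)%:R * c (dec_at k n).
Proof.
rewrite rhoX; congr (_ * c _).
  rewrite /mono_coef (bigD1 k) //= big1 => [|i nik].
    by rewrite !mnm1E eqxx eq_lrshift /hk /= !mulr1.
  by rewrite !mnm1E eq_lshift [k == i]eq_sym (negbTE nik) eq_lrshift /hk /= mulr1.
apply/ffunP => i; rewrite !ffunE !mnm1E eq_lrshift eq_lshift addr0 [k == i]eq_sym.
by case: eqP.
Qed.

Lemma rho_wd k c n :
  rho (wd k) c n = hwt _ (n k) * c [ffun i => n i + (i == k)%:Z].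
Proof.
rewrite rhoX; congr (_ * c _).
  rewrite /mono_coef (bigD1 k) //= big1 => [|i nik].
    by rewrite !mnm1E eqxx eq_rlshift /hk /= subr0 !mulr1 mul1r.
  by rewrite !mnm1E eq_rshift [k == i]eq_sym (negbTE nik) eq_rlshift /hk /= mulr1.
apply/ffunP => i; rewrite !ffunE !mnm1E eq_rlshift eq_rshift subr0 [k == i]eq_sym.
by case: eqP.
Qed.

Lemma rho_euler k c n : rho (weyl_mul (wx k) (wd k)) c n = (n k)%:~R * c n.
Proof.
rewrite rho_mul rho_wx rho_wd ffunE eqxx.
have -> : [ffun i => dec_at k n i + (i == k)%:Z] = n.
  by apply/ffunP => i; rewrite !ffunE subrK.
(* At [n k = 0] the weight is 1 instead of [n k], but x delta = 0 removes the term. *)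
case: (eqVneq (n k) 0) => [->|nk0]; first by rewrite !mul0r.
have hw : hwt CC (n k - 1%:Z) = (n k)%:~R.
  rewrite /hwt subrK; case: eqP => // e; exfalso; move/eqP: nk0; apply; lia.
by rewrite mul1r hw.
Qed.

Lemma rho_theta c n : rho (theta m) c n = (\sum_i (n i)%:~R) * c n.
Proof.
rewrite /theta rho_sum mulr_suml.
by apply: eq_bigr => i _; rewrite rho_euler.
Qed.

Lemma rho_prod_diag p (T : 'I_p -> Weyl m) (e : 'I_p -> {ffun 'I_m -> int} -> CC) c n :
  (forall i c n, rho (T i) c n = e i n * c n) ->
  rho (\big[@weyl_mul m/1]_(i < p) T i) c n = (\prod_(i < p) e i n) * c n.
Proof.
move=> hT; elim: (index_enum _) c n => [|i r IH] c n.
  by rewrite !big_nil rho1 mul1r.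
by rewrite !big_cons rho_mul hT IH mulrA.
Qed.

(** Euler operators are diagonal in this basis, so annihilation by [ell a b k] is a two-term
    recurrence in direction k. *)
Lemma rho_ell p (a : 'I_p -> CC) (b : 'I_p -> 'I_m -> CC) k c n :
  rho (ell a b k) c n =
  (\prod_(i < p) ((n k)%:~R + b i k - 1)) * c n
  - (n k != 0)%:R * ((\prod_(i < p) (\sum_j (dec_at k n j)%:~R + a i)) * c (dec_at k n)).
Proof.
rewrite /ell rhoB; congr (_ - _).
  apply: (rho_prod_diag _ _ (fun i n => (n k)%:~R + b i k - 1)) => i c' n'.
  by rewrite rhoD rho_euler rho_wc -mulrDl addrA.
rewrite rho_mul rho_wx; congr (_ * _).
apply: (rho_prod_diag _ _ (fun i n => \sum_j (n j)%:~R + a i)) => i c' n'.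
by rewrite rhoD rho_theta rho_wc -mulrDl.
Qed.

Lemma in_ideal_annihilates p (a : 'I_p -> CC) (b : 'I_p -> 'I_m -> CC) P c :
  (forall k n, rho (ell a b k) c n = 0) -> in_ideal a b P -> forall n, rho P c n = 0.
Proof.
move=> hc [Q ->] n; rewrite rho_sum big1 // => k _.
rewrite rho_mul (eq_rho _ _ (fun=> 0)) ?/rho => [|n']; last exact: hc.
by rewrite /mlin big1 // => s _; rewrite !mulr0.
Qed.

End HeavisideModule.

(** * The hypergeometric series *)

(** The rising factorial, over a general ring because it is needed for scalars and for
    polynomials. *)
Definition poch (R : nzRingType) (x : R) n : R := \prod_(l < n) (x + l%:R).

Lemma pochD (R : nzRingType) (x : R) n1 n2 : poch R x (n1 + n2) = poch R x n1 * poch R (x + n1%:R) n2.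
Proof.
rewrite /poch big_split_ord /=; congr (_ * _).
by apply: eq_bigr => i _; rewrite natrD addrA.
Qed.

Lemma rmorph_poch (R S : nzRingType) (f : {rmorphism R -> S}) x n :
  f (poch R x n) = poch S (f x) n.
Proof. by rewrite rmorph_prod; apply: eq_bigr => i _; rewrite rmorphD rmorph_nat. Qed.

Section HypergeometricSeries.
Variables (m p : nat) (a : 'I_p -> CC) (b : 'I_p -> 'I_m -> CC).
Hypothesis b_ne : forall i k (l : nat), b i k + l%:R != 0.
Hypothesis b_one : forall k, exists i, b i k = 1.

(** The coefficients A(j) of the Lauricella type series F_C. *)
Definition fc_coef (j : 'I_m -> nat) : CC :=
  (\prod_(i < p) poch _ (a i) (\sum_k j k)%N) / \prod_(k < m) \prod_(i < p) poch _ (b i k) (j k).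

Lemma eq_fc_coef j j' : j =1 j' -> fc_coef j = fc_coef j'.
Proof.
move=> e; congr (_ / _); first by apply: eq_bigr => i _; rewrite (eq_bigr j').
by apply: eq_bigr => k _; rewrite e.
Qed.

Lemma poch_b_neq0 i k n : poch _ (b i k) n != 0.
Proof. exact/prodf_neq0. Qed.

Lemma fc_coefS j k :
  (\prod_(i < p) (b i k + (j k)%:R)) * fc_coef (fun i => j i + (i == k))%N
  = (\prod_(i < p) (a i + (\sum_i j i)%:R)) * fc_coef j.
Proof.
rewrite /fc_coef !mulrA.
have -> : (\sum_i (j i + (i == k)) = \sum_i j i + 1)%N.
  rewrite big_split /=; congr (_ + _)%N.
  by rewrite (bigD1 k) //= eqxx big1 // => i /negbTE ->.
move: (\sum_i j i)%N => J.
have pochS (x : CC) n : poch _ x (n + 1) = poch _ x n * (x + n%:R).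
  by rewrite pochD /poch big_ord1 addr0.
rewrite (eq_bigr (fun i => poch _ (a i) J * (a i + J%:R)) (fun i _ => pochS _ _)).
rewrite [in LHS]big_split /=.
rewrite (bigD1 k) //= [in RHS](bigD1 k) //= eqxx.
under [X in _ / (X * _)]eq_bigr => i _ do rewrite pochS.
rewrite [X in _ / (X * _)]big_split /=.
under [X in _ / (_ * X)]eq_bigr => i /negbTE -> do under eq_bigr => i' _ do rewrite addn0.
have h1 : \prod_(i < p) (b i k + (j k)%:R) != 0 by apply/prodf_neq0.
have h2 : \prod_(i < p) poch CC (b i k) (j k) != 0 by apply/prodf_neq0 => i _; apply: poch_b_neq0.
have h3 : \prod_(i < m | i != k) \prod_(i' < p) poch CC (b i' i) (j i) != 0.
  by apply/prodf_neq0 => i _; apply/prodf_neq0 => i' _; apply: poch_b_neq0.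
by field; rewrite h1 h2 h3.
Qed.

(** Extension by zero to Z^m: this is the product with the Heaviside functions. *)
Definition fc_series (n : {ffun 'I_m -> int}) : CC :=
  if [forall k, 0 <= n k] then fc_coef (fun k => `|n k|%N) else 0.

Lemma fc_series_nat (j : 'I_m -> nat) : fc_series [ffun k => (j k)%:Z] = fc_coef j.
Proof.
rewrite /fc_series ifT; last by apply/forallP => k; rewrite ffunE.
by apply: eq_fc_coef => k; rewrite ffunE.
Qed.

Lemma rho_ell_fc k n : rho _ (ell a b k) fc_series n = 0.
Proof.
(* On the boundary [n k = 0] the first product contains the factor b - 1 = 0 for the parameter equal
   to 1, and the second term is cut off by x delta = 0. *)
rewrite rho_ell; case: (eqVneq (n k) 0) => [nk0|nk0].
  have [i bi1] := b_one k.
  by rewrite nk0 (bigD1 i) //= bi1 add0r subrr !mul0r subrr.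
rewrite mul1r; case: (boolP [forall k, 0 <= n k]) => [n_ge0|]; last first.
  move=> n_neg; rewrite /fc_series (negbTE n_neg) mulr0 ifN ?mulr0 ?subrr //.
  move: n_neg; rewrite !negb_forall; case/existsP => i ni; apply/existsP; exists i.
  by rewrite ffunE; case: (i == k); lia.
have nd i : dec_at _ k n i = (`|n i| - (i == k))%N%:Z.
  move/forallP: n_ge0 => n_ge0; rewrite ffunE; have := n_ge0 i.
  by case: eqP => [->|_]; move: (n_ge0 k) nk0; lia.
pose j i := (`|n i| - (i == k))%N.
have -> : fc_series n = fc_coef (fun i => j i + (i == k))%N.
  rewrite /fc_series n_ge0; apply: eq_fc_coef => i; rewrite /j.
  by case: eqP => [->|_]; move: nk0; lia.
have -> : fc_series (dec_at _ k n) = fc_coef j.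
  rewrite -fc_series_nat; congr fc_series; apply/ffunP => i.
  by rewrite nd ffunE.
rewrite (_ : \prod_(i < p) _ = \prod_(i < p) (b i k + (j k)%:R)); last first.
  apply: eq_bigr => i _.
  have -> : n k = (j k)%:Z + 1 by move/forallP: n_ge0 => /(_ k); rewrite /j eqxx; lia.
  by rewrite rmorphD /= -pmulrn; ring.
rewrite fc_coefS (_ : \prod_(i < p) (\sum_j _ + a i) = \prod_(i < p) (a i + (\sum_i j i)%:R)) ?subrr //.
apply: eq_bigr => i _; rewrite addrC natr_sum; congr (_ + _).
by apply: eq_bigr => i' _; rewrite nd -pmulrn.
Qed.

Lemma fc_series_neq0 n : fc_series n != 0 -> forall k, 0 <= n k.
Proof. by rewrite /fc_series; case: ifP => [/forallP //|_]; rewrite eqxx. Qed.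

Lemma rho_in_ideal P : in_ideal a b P -> forall n, rho _ P fc_series n = 0.
Proof. exact/in_ideal_annihilates/rho_ell_fc. Qed.

(** * Points of the characteristic variety over x_k = 0 *)

Lemma hd_neq0 g n : hd CC g n != 0.
Proof.
elim: g n => [|g IH] n /=; first exact: oner_neq0.
rewrite mulf_neq0 ?IH // /hwt; case: (eqVneq n (-1)) => [_|ne]; first exact: oner_neq0.
by rewrite intr_eq0; lia.
Qed.

Lemma hx_nat al : hx CC al al%:Z = 1.
Proof.
elim: al => [//|al IH] /=; rewrite mul1r -IH; congr hx; lia.
Qed.

Lemma fc_series0 : fc_series [ffun=> 0] = 1.
Proof.
rewrite (_ : [ffun=> 0] = [ffun k : 'I_m => (0%N : nat)%:Z]) // fc_series_nat /fc_coef.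
rewrite big1 => [|i _]; last by rewrite big1 /poch ?big_ord0.
by rewrite big1 ?divr1 // => k _; rewrite big1 // => i _; rewrite /poch big_ord0.
Qed.

(* Reads off the coefficient of P F at x^(alpha) delta^(d-1)(x_k), alpha minimal. *)
Lemma hyperplane_coef_eq0 P k (d := dorder P) (s : 'X_{1..m + m}) :
  in_ideal a b P -> s (lshift m k) = 0%N -> (forall i, i != k -> s (rshift m i) = 0%N) ->
  s (rshift m k) = d -> P@_s = 0.
Proof.
(* Induction on the x-degree of [s]: monomials of smaller x-degree are already known to be absent
   from [P]. *)
move=> /rho_in_ideal hP.
have [N] := ubnP (\sum_i s (lshift m i)); elim: N s => // N IH s0 leN s0l s0r s0d.
apply/eqP; rewrite mcoeff_eq0; apply/negP => s0P.
(* At this index [s] contributes only if its k-th shift reaches 0 from -d. Since [s] has order at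
   most d, it must then be free of x_k and have all its d derivatives in direction k. *)
pose n : {ffun 'I_m -> int} := [ffun i => if i == k then - d%:Z else (s0 (lshift m i))%:Z].
have := hP n; rewrite /rho /mlin (bigD1_seq s0) ?msupp_uniq //= big1_seq ?addr0; last first.
  move=> s /andP[s_ne sP]; apply/eqP; apply: contraT; rewrite !mulf_eq0 !negb_or => /and3P[Ps _ us].
  have {us} sh i := fc_series_neq0 _ us i.
  have dle : (dorder_mono s <= d)%N by apply: (leq_bigmax_seq (F := @dorder_mono m)).
  have /andP[sk slk] : (s (rshift m k) == d) && (s (lshift m k) == 0%N).
    move: (sh k) dle; rewrite /dorder_mono (bigD1 k) //= !ffunE eqxx; lia.
  move/eqP: sk => sk; move/eqP: slk => slk.
  have sr i : i != k -> s (rshift m i) = 0%N.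
    move=> nik; move: dle; rewrite /dorder_mono (bigD1 k) //= (bigD1 i) //= sk; lia.
  have le_l i : (s (lshift m i) <= s0 (lshift m i))%N.
    case: (eqVneq i k) => [->|nik]; first by rewrite slk.
    by move: (sh i); rewrite !ffunE (negbTE nik) (sr _ nik); lia.
  case: (ltnP (\sum_i s (lshift m i)) (\sum_i s0 (lshift m i))) => [lt_s|ge_s].
    have := IH s (leq_trans lt_s _) slk sr sk; rewrite -ltnS => /(_ leN) P0.
    by rewrite P0 eqxx in Ps.
  case/eqP: s_ne; apply/mnmP => i; rewrite -(splitK i); case: (split i) => i' /=; last first.
    case: (eqVneq i' k) => [->|nik]; first by rewrite sk s0d.
    by rewrite sr ?s0r.
  apply/eqP; rewrite eqn_leq le_l /= leqNgt; apply/negP => lt_i.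
  move: ge_s; rewrite leqNgt => /negP; apply.
  rewrite (bigD1 i') //= [X in (_ < X)%N](bigD1 i') //= -addSn leq_add //.
  by apply: leq_sum.
move/eqP; apply/negP; rewrite !mulf_neq0 //; first by rewrite -mcoeff_msupp.
  apply/prodf_neq0 => i _; rewrite ffunE /hk; case: (eqVneq i k) => [->|nik].
    by rewrite s0l mul1r hd_neq0.
  by rewrite hx_nat s0r // mul1r oner_eq0.
rewrite (_ : mono_shift _ _ _ = [ffun=> 0]) ?fc_series0 ?oner_eq0 //.
apply/ffunP => i; rewrite !ffunE; case: (eqVneq i k) => [->|nik]; first by rewrite s0l s0d; lia.
by rewrite s0r //; lia.
Qed.

(** At such a point only the monomials x^alpha xi_k^d with alpha_k = 0 survive in the symbol, and
    their coefficients have just been shown to vanish. *)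
Lemma charvar_hyperplane k (v : 'I_(m + m) -> CC) :
  v (lshift m k) = 0 -> (forall i, v (rshift m i) = (i == k)%:R) -> charvar a b v.
Proof.
move=> vl vr P hP; rewrite /psymb raddf_sum /= big1 // => s /eqP sd.
rewrite mevalZ mevalX big_split_ord /= (bigD1 k) //= vl.
case: (eqVneq (s (lshift m k)) 0%N) => [slk|]; last by move=> h; rewrite expr0n (negbTE h) !mul0r mulr0.
case: (boolP [exists i, (i != k) && (s (rshift m i) != 0%N)]).
  case/existsP => i /andP[nik si].
  rewrite [X in _ * (_ * X)](_ : _ = 0) ?mulr0 // (bigD1 i) //=.
  by rewrite vr (negbTE nik) expr0n (negbTE si) mul0r.
move/existsPn => h; have sr i : i != k -> s (rshift m i) = 0%N.
  by move=> nik; have := h i; rewrite nik /= negbK => /eqP.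
rewrite (hyperplane_coef_eq0 _ _ _ hP slk sr) ?mul0r // -sd /dorder_mono (bigD1 k) //= big1 ?addn0 //.
Qed.

End HypergeometricSeries.

(** * Polynomials that vanish at all natural points *)

Lemma poly_nat_eq0 (K : numFieldType) (q : {poly K}) : (forall l : nat, q.[l%:R] = 0) -> q = 0.
Proof.
move=> q0; apply/eqP; apply: contraT => q_ne.
have := @max_poly_roots _ q [seq l%:R | l <- iota 0 (size q)] q_ne.
rewrite size_map size_iota ltnn => -> //.
  by apply/allP => _ /mapP[l _ ->]; rewrite /root q0.
by rewrite map_inj_uniq ?iota_uniq // => l l' /eqP; rewrite eqr_nat => /eqP.
Qed.

Lemma horner_mmap n (K : comNzRingType) (h : 'I_n -> {poly K}) (q : {mpoly K[n]}) t :
  (mmap polyC h q).[t] = q.@[fun i => (h i).[t]].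
Proof.
rewrite /mmap horner_sum mevalE; apply: eq_bigr => s _.
rewrite hornerM hornerC /mmap1 horner_prod; congr (_ * _).
by apply: eq_bigr => i _; rewrite horner_exp.
Qed.

Lemma mpoly_nat_eq0 n (K : numFieldType) (q : {mpoly K[n]}) :
  (forall j : 'I_n -> nat, q.@[fun i => (j i)%:R] = 0) -> forall w, q.@[w] = 0.
Proof.
move=> q0 w.
(* The variables are freed one at a time: those of index at least [r] are still natural numbers. *)
suff H r : forall w : 'I_n -> K, (forall i : 'I_n, (r <= i)%N -> exists l : nat, w i = l%:R) -> q.@[w] = 0.
  by apply: (H n) => i; rewrite leqNgt ltn_ord.
elim: r => [|r IH] {}w hw.
  have [|j hj] := fin_all_exists (P := fun i l => w i = l%:R); first by move=> i; apply: hw.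
  by rewrite (meval_eq _ hj).
case: (ltnP r n) => [lt_rn|le_nr]; last first.
  by apply: IH => i le_ri; have := ltn_ord i; rewrite ltnNge (leq_trans le_nr le_ri).
pose i0 := Ordinal lt_rn.
pose h i : {poly K} := if i == i0 then 'X else (w i)%:P.
have hE t : (mmap polyC h q).[t] = q.@[fun i => if i == i0 then t else w i].
  by rewrite horner_mmap; apply: meval_eq => i; rewrite /h; case: ifP; rewrite ?hornerX ?hornerC.
have -> : q.@[w] = (mmap polyC h q).[w i0].
  by rewrite hE; apply: meval_eq => i; case: eqP => [->|].
rewrite (@poly_nat_eq0 _ (mmap polyC h q)) ?horner0 // => l; rewrite hE; apply: IH => i le_ri.
case: eqP => [_|ne]; first by exists l.
by apply: hw; rewrite ltn_neqAle le_ri andbT; apply/eqP => e; apply: ne; apply: val_inj.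
Qed.

(** * Leading coefficients with a prescribed degree bound *)

(** The coefficient [c] may be zero, so that terms of lower degree can be summed with the others. *)
Definition top_coef (R : nzRingType) n (q : {poly R}) c := (size q <= n.+1)%N /\ q`_n = c.

Section TopCoef.
Variable R : comNzRingType.
Implicit Types (q : {poly R}) (c : R).

Lemma top_coef_lt n q : (size q <= n)%N -> top_coef R n q 0.
Proof. by move=> h; split; [exact: leqW | exact: nth_default]. Qed.

Lemma top_coefM n n' q q' c c' :
  top_coef R n q c -> top_coef R n' q' c' -> top_coef R (n + n') (q * q') (c * c').
Proof.
move=> [hq <-] [hq' <-]; split.
  by apply: leq_trans (size_polyMleq _ _) _; move: (size q) (size q') hq hq'; lia.
have le_n : (n < (n + n').+1)%N by rewrite ltnS leq_addr.
rewrite coefM (bigD1 (Ordinal le_n)) //= addKn big1 ?addr0 // => i ne_i.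
case: (ltngtP i n) => [lt_in|lt_ni|eq_in].
- by rewrite [q'`__]nth_default ?mulr0 //; apply: leq_trans hq' _; lia.
- by rewrite [q`__]nth_default ?mul0r //; apply: leq_trans hq _.
- by case/eqP: ne_i; apply: val_inj.
Qed.

Lemma top_coef_sum I (r : seq I) (P : pred I) n (q : I -> {poly R}) (c : I -> R) :
  (forall i, P i -> top_coef R n (q i) (c i)) ->
  top_coef R n (\sum_(i <- r | P i) q i) (\sum_(i <- r | P i) c i).
Proof.
move=> h; split; last by rewrite coef_sum; apply: eq_bigr => i /h[].
apply: (big_ind (fun q : {poly R} => size q <= n.+1)%N); rewrite ?size_poly0 //.
  by move=> x y hx hy; apply: leq_trans (size_polyD _ _) _; rewrite geq_max hx.
by move=> i /h[].
Qed.

Lemma top_coef_sum_seq (I : eqType) (r : seq I) n (q : I -> {poly R}) (c : I -> R) :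
  {in r, forall i, top_coef R n (q i) (c i)} ->
  top_coef R n (\sum_(i <- r) q i) (\sum_(i <- r) c i).
Proof. by move=> h; rewrite big_seq [X in top_coef _ _ _ X]big_seq; apply: top_coef_sum. Qed.

Lemma top_coefD n q q' c c' :
  top_coef R n q c -> top_coef R n q' c' -> top_coef R n (q + q') (c + c').
Proof.
move=> [hq <-] [hq' <-]; split; last by rewrite coefD.
by apply: leq_trans (size_polyD _ _) _; rewrite geq_max hq.
Qed.

Lemma top_coefC c : top_coef R 0 c%:P c.
Proof. by split; [exact: size_polyC_leq1 | rewrite coefC]. Qed.

Lemma top_coef_prod I (r : seq I) (P : pred I) n (q : I -> {poly R}) (c : I -> R) :
  (forall i, P i -> top_coef R (n i) (q i) (c i)) ->
  top_coef R (\sum_(i <- r | P i) n i) (\prod_(i <- r | P i) q i) (\prod_(i <- r | P i) c i).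
Proof.
move=> h; elim: r => [|i r IH]; first by rewrite !big_nil; apply: top_coefC.
by rewrite !big_cons; case: ifP => // Pi; apply: top_coefM => //; apply: h.
Qed.

Lemma top_coef_addC q c x : top_coef R 1 q c -> top_coef R 1 (q + x%:P) c.
Proof.
move=> h; rewrite -[c]addr0; apply: top_coefD => //.
by apply: top_coef_lt; apply: size_polyC_leq1.
Qed.

Lemma top_coef_poch q c n : top_coef R 1 q c -> top_coef R n (poch _ q n) (c ^+ n).
Proof.
move=> h; rewrite -[n in top_coef _ n](card_ord n) -sum1_card -[n in c ^+ n](card_ord n) -prodr_const.
by apply: top_coef_prod => l _; rewrite -polyC_natr; apply: top_coef_addC.
Qed.

Lemma top_coefZX c : top_coef R 1 (c *: 'X) c.
Proof.
split; last by rewrite coefZ coefX eqxx mulr1.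
by apply: leq_trans (size_scale_leq _ _) _; rewrite size_polyX.
Qed.

End TopCoef.

(** * Points of the characteristic variety with all x_k nonzero *)

(** Used with x = x_k, y = xi_k, z = S^p, where x y = w_k and x z = w_k^p: it turns a monomial of
    the symbol into a factor of the leading coefficient of [fc_numerator]. *)
Lemma monomial_exchange (R : comNzRingType) (x y z : R) sl sr M L (e := (M - sl + sr)%N) :
  (sl <= M)%N -> (e <= L)%N ->
  x ^+ sl * y ^+ sr * (x * z) ^+ L = (x * y) ^+ sr * z ^+ e * (x * z) ^+ (L - e) * x ^+ M.
Proof.
move=> le_sM le_eL.
have -> : x ^+ M = x ^+ sl * x ^+ (M - sl) by rewrite -exprD subnKC.
have -> : (x * z) ^+ L = (x * z) ^+ e * (x * z) ^+ (L - e) by rewrite -exprD subnKC.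
by rewrite !exprMn /e !exprD; ring.
Qed.

Section GenericPoints.
Variables (m p : nat) (a : 'I_p -> CC) (b : 'I_p -> 'I_m -> CC).
Hypothesis b_ne : forall i k (l : nat), b i k + l%:R != 0.
Hypothesis b_one : forall k, exists i, b i k = 1.
Hypothesis a_ne : forall i (l : nat), a i + l%:R != 0.

(** All A(j + g) with g bounded by [L] get the same denominator; what remains besides the rising
    factorials of the a_i at |j| is polynomial in j. *)
Lemma fc_coef_add (j g : 'I_m -> nat) L : (forall k, (g k <= L)%N) ->
  fc_coef _ _ a b (fun k => j k + g k)%N * \prod_(k < m) \prod_(i < p) poch _ (b i k) (j k + L)
  = (\prod_(i < p) poch _ (a i) (\sum_k j k)) *
    (\prod_(i < p) poch _ (a i + (\sum_k j k)%:R) (\sum_k g k)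
     * \prod_(k < m) \prod_(i < p) poch _ (b i k + (j k)%:R + (g k)%:R) (L - g k)).
Proof.
move=> le_gL; rewrite /fc_coef.
have -> : \prod_(i < p) poch _ (a i) (\sum_k (j k + g k)) =
  (\prod_(i < p) poch _ (a i) (\sum_k j k)) * \prod_(i < p) poch _ (a i + (\sum_k j k)%:R) (\sum_k g k).
  rewrite -big_split; apply: eq_bigr => i _ /=.
  by rewrite [X in poch _ _ X](big_split _ _ _ j g) pochD.
rewrite -!mulrA; congr (_ * (_ * _)).
set X := (X in X^-1 * _); have X_ne : X != 0.
  by apply/prodf_neq0 => k _; apply/prodf_neq0 => i _; apply: poch_b_neq0.
apply: (canLR (mulKf X_ne)); rewrite -big_split /=; apply: eq_bigr => k _.
rewrite -big_split /=; apply: eq_bigr => i _.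
by rewrite -[(j k + L)%N](_ : j k + g k + (L - g k) = _)%N ?pochD ?natrD ?addrA // -addnA subnKC.
Qed.

(** The monomial [s] reads A at j + [shift_exp M s] when the coefficient is taken at x^(M+j). [M]
    will bound the x-exponents, so the subtraction is not truncated. *)
Definition shift_exp M (s : 'X_{1..m + m}) k := (M - s (lshift m k) + s (rshift m k))%N.

(* Up to a nonzero factor, the coefficient of P F at x^(M + j), as a polynomial in j. *)
Definition fc_numerator (P : Weyl m) M L : {mpoly CC[m]} :=
  \sum_(s <- msupp P) P@_s *:
    ((\prod_(k < m) poch _ ('X_k + ((M - s (lshift m k)).+1%:R)%:MP) (s (rshift m k)))
     * (\prod_(i < p) poch _ ((\sum_k 'X_k) + (a i)%:MP) (\sum_k shift_exp M s k)
        * \prod_(k < m) \prod_(i < p) poch _ ('X_k + (b i k + (shift_exp M s k)%:R)%:MP) (L - shift_exp M s k))).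

Lemma hx_ge al l : (al <= l)%N -> hx CC al l%:Z = 1.
Proof.
elim: al l => [//|al IH] [//|l] h /=; rewrite mul1r.
by rewrite (_ : l.+1%:Z - 1 = l%:Z) ?IH //; lia.
Qed.

Lemma hd_nat g (l : nat) : hd CC g l%:Z = poch _ l.+1%:R g.
Proof.
elim: g l => [|g IH] l; first by rewrite /poch big_ord0.
rewrite /= (_ : l%:Z + 1 = l.+1%:Z) ?IH; last lia.
rewrite -[g.+1 in RHS]add1n pochD -(natrD _ l.+1 1) addn1 [poch _ _ 1]big_ord1 addr0.
by rewrite /hwt -PoszD addn1.
Qed.

(** The coefficient of P F at x^(M+j) is zero. Clearing its denominators and cancelling the nonzero
    factor common to all terms leaves the value of [fc_numerator] at j. *)
Lemma fc_numerator_eval P M L (j : 'I_m -> nat) : in_ideal a b P ->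
  (forall s k, s \in msupp P -> (s (lshift m k) <= M)%N) ->
  (forall s k, s \in msupp P -> (shift_exp M s k <= L)%N) ->
  (fc_numerator P M L).@[fun k => (j k)%:R] = 0.
Proof.
move=> hP leM leL.
pose n : {ffun 'I_m -> int} := [ffun k => (M + j k)%:Z].
pose A := \prod_(i < p) poch CC (a i) (\sum_k j k).
have A_ne : A != 0 by apply/prodf_neq0 => i _; apply/prodf_neq0.
apply: (mulfI A_ne); rewrite mulr0.
have := congr1 ( *%R^~ (\prod_(k < m) \prod_(i < p) poch _ (b i k) (j k + L))) (rho_in_ideal _ _ _ _ b_ne b_one _ hP n).
rewrite mul0r => <-; rewrite /fc_numerator raddf_sum /rho /mlin mulr_sumr mulr_suml.
apply: eq_big_seq => s sP.
rewrite /= mevalZ mulrCA -!mulrA; congr (_ * _).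
rewrite (_ : mono_shift _ s n = [ffun k => (j k + shift_exp M s k)%N%:Z]); last first.
  by apply/ffunP => k; rewrite !ffunE /shift_exp; have := leM s k sP; lia.
rewrite fc_series_nat fc_coef_add; last by move=> k; apply: leL.
rewrite [RHS]mulrCA; congr (_ * _).
rewrite !mevalM !rmorph_prod /=; congr (_ * (_ * _)).
- apply: eq_bigr => k _; rewrite rmorph_poch /= mevalD mevalXU mevalC ffunE /hk.
  rewrite hx_ge ?mul1r; last by rewrite (leq_trans (leM s k sP)) ?leq_addr.
  rewrite (_ : (M + j k)%N%:Z - _ = (M - s (lshift m k) + j k)%N%:Z); last first.
    by have := leM s k sP; lia.
  by rewrite hd_nat -natrD addnC addSn.
- apply: eq_bigr => i _; rewrite rmorph_poch /= mevalD mevalC raddf_sum /= addrC natr_sum.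
  by congr (poch _ (_ + _) _); apply: eq_bigr => k _; rewrite mevalXU.
apply: eq_bigr => k _; rewrite rmorph_prod; apply: eq_bigr => i _.
by rewrite rmorph_poch /= mevalD mevalXU mevalC addrA [(j k)%:R + _]addrC.
Qed.

(** Restricted to the line j = t w, each linear form in j has leading coefficient w_k or the sum of
    the w_k, whatever its constant term. *)
Lemma fc_numerator_top P M L (w : 'I_m -> CC) (d := dorder P) :
  (forall s k, s \in msupp P -> (shift_exp M s k <= L)%N) ->
  top_coef _ (d + p * (m * L)) (mmap polyC (fun k => w k *: 'X) (fc_numerator P M L))
    (\sum_(s <- msupp P | dorder_mono s == d) P@_s *
      \prod_(k < m) (w k ^+ s (rshift m k) * ((\sum_k w k) ^+ p) ^+ shift_exp M s k
                      * (w k ^+ p) ^+ (L - shift_exp M s k))).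
Proof.
move=> leL; rewrite /fc_numerator raddf_sum /= [X in top_coef _ _ _ X]big_mkcond /=.
apply: top_coef_sum_seq => s sP /=.
set e := shift_exp M s; rewrite mmapZ !rmorphM !rmorph_prod /=.
pose E := (\sum_k e k)%N.
have tX k x : top_coef CC 1 (mmap polyC (fun k => w k *: 'X) ('X_k + x%:MP)) (w k).
  by rewrite mmapD mmapC mmapX mmap1U; apply: top_coef_addC; apply: top_coefZX.
have tS x : top_coef CC 1 (mmap polyC (fun k => w k *: 'X) (\sum_k 'X_k + x%:MP)) (\sum_k w k).
  rewrite mmapD mmapC raddf_sum; apply: top_coef_addC; apply: top_coef_sum => k _ /=.
  by rewrite mmapX mmap1U; apply: top_coefZX.
have := top_coefM _ _ _ _ _ _ _ (top_coefC _ P@_s)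
  (top_coefM _ _ _ _ _ _ _
    (top_coef_prod _ _ (index_enum _) xpredT _ _ _ (fun k _ => top_coef_poch _ _ _ (s (rshift m k)) (tX k (M - s (lshift m k)).+1%:R)))
    (top_coefM _ _ _ _ _ _ _
      (top_coef_prod _ _ (index_enum _) xpredT _ _ _ (fun i _ => top_coef_poch _ _ _ E (tS (a i))))
      (top_coef_prod _ _ (index_enum _) xpredT _ _ _ (fun k _ =>
         top_coef_prod _ _ (index_enum _) xpredT _ _ _ (fun i _ => top_coef_poch _ _ _ (L - e k) (tX k (b i k + (e k)%:R))))))).
(* The exponents e_k and L - e_k add up to L, so the degree depends on [s] only through its
   order. *)
have -> : (0 + (\sum_(k < m) s (rshift m k) + (\sum_(i < p) E + \sum_(k < m) \sum_(i < p) (L - e k)))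
           = dorder_mono s + p * (m * L))%N.
  rewrite add0n; congr (_ + _)%N; rewrite sum_nat_const card_ord.
  under eq_bigr => k _ do rewrite sum_nat_const card_ord.
  rewrite -big_distrr /= -mulnDr /E -big_split /=.
  under eq_bigr => k _ do rewrite subnKC ?leL //.
  by rewrite sum_nat_const card_ord.
set q1 := (X in top_coef _ _ X _ -> _); set q2 := (X in _ -> top_coef _ _ X _); have -> : q2 = q1.
  rewrite /q1 /q2; congr (_ * (_ * (_ * _))); apply: eq_bigr => k _; rewrite ?rmorph_poch //.
  by rewrite rmorph_prod; apply: eq_bigr => i _; rewrite rmorph_poch.
case: eqP => [->|/eqP ne_d] h; last first.
  case: h => h _; apply: top_coef_lt; apply: leq_trans h _.
  rewrite -addSn leq_add2r ltn_neqAle ne_d /=.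
  exact: (leq_bigmax_seq (F := @dorder_mono m)).
rewrite (_ : \prod_(k < m) _ = \prod_i w i ^+ s (rshift m i) *
      (\prod_(i < p) (\sum_k w k) ^+ E * \prod_i \prod_(i0 < p) w i ^+ (L - e i))) //.
rewrite prodr_const card_ord -exprM mulnC exprM /E -prodrXr -!big_split /=.
apply: eq_bigr => k _; rewrite prodr_const card_ord -mulrA; congr (_ * (_ * _)).
by rewrite -!exprM mulnC.
Qed.

Lemma charvar_generic (v : 'I_(m + m) -> CC) (S := \sum_k v (lshift m k) * v (rshift m k)) :
  (forall k, v (lshift m k) != 0) -> S != 0 ->
  (forall k, (v (lshift m k) * v (rshift m k)) ^+ p = v (lshift m k) * S ^+ p) ->
  charvar a b v.
Proof.
move=> x_ne S_ne hv P hP.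
pose x k := v (lshift m k); pose w k := x k * v (rshift m k).
pose M := msize P; pose L := (M + M)%N.
have le_s s i : s \in msupp P -> (s i <= M)%N.
  by move/msize_mdeg_lt/ltnW; apply: leq_trans; rewrite mdegE (bigD1 i) //= leq_addr.
have leL s k : s \in msupp P -> (shift_exp M s k <= L)%N.
  by move=> sP; rewrite /shift_exp leq_add ?leq_subr ?le_s.
(* [fc_numerator] vanishes on N^m, hence at every point of the line spanned by w. *)
have q0 : mmap polyC (fun k => w k *: 'X) (fc_numerator P M L) = 0.
  apply: poly_nat_eq0 => l; rewrite horner_mmap.
  apply: mpoly_nat_eq0 => j; apply: fc_numerator_eval => // s k; exact: le_s.
have [_] := fc_numerator_top P M L w leL; rewrite q0 coef0 => /esym top0.
(* Multiplied by this nonzero factor, the symbol at v becomes the vanishing leading coefficient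
   times the product of the x_k^M. *)
have K_ne : \prod_(k < m) (w k ^+ p) ^+ L != 0.
  by apply/prodf_neq0 => k _; rewrite /w hv expf_neq0 // mulf_neq0 // expf_neq0.
apply: (mulIf K_ne); rewrite mul0r -[RHS](mul0r (\prod_(k < m) x k ^+ M)) -[in RHS]top0.
rewrite /psymb raddf_sum /= !mulr_suml big_seq_cond [RHS]big_seq_cond.
apply: eq_bigr => s /andP[sP _]; rewrite mevalZ -!mulrA; congr (_ * _).
rewrite mevalX big_split_ord /= -!big_split /=; apply: eq_bigr => k _.
by rewrite -/S [w k ^+ p]hv -/(x k) (monomial_exchange _ _ _ _ _ _ M) ?le_s //; apply: leL.
Qed.

End GenericPoints.

(** * Principal symbols of the generators *)

Section Symbols.
Variable m : nat.
Implicit Types (s t : 'X_{1..m + m}) (P Q c q : {mpoly CC[m + m]}).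

Lemma dorder_monoD s t : dorder_mono (s + t)%MM = (dorder_mono s + dorder_mono t)%N.
Proof. by rewrite /dorder_mono -big_split; apply: eq_bigr => i _; rewrite mnmDE. Qed.

(* P has order at most d and c is its (possibly zero) component of order d. *)
Definition is_symb d P c := forall s,
  ((d < dorder_mono s)%N -> P@_s = 0) /\ c@_s = if dorder_mono s == d then P@_s else 0.

Lemma is_symb_sum I (r : seq I) (A : pred I) d (P c : I -> {mpoly CC[m + m]}) :
  (forall i, A i -> is_symb d (P i) (c i)) ->
  is_symb d (\sum_(i <- r | A i) P i) (\sum_(i <- r | A i) c i).
Proof.
move=> h s; rewrite !raddf_sum /=; split.
  by move=> ds; rewrite big1 // => i Ai; have [h0 _] := h i Ai s; apply: h0.
case: eqP => ds; last by rewrite big1 // => i Ai; have [_ ->] := h i Ai s; case: eqP.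
by apply: eq_bigr => i Ai; have [_ ->] := h i Ai s; rewrite ds eqxx.
Qed.

Lemma is_symb_sum_seq (I : eqType) (r : seq I) d (P c : I -> {mpoly CC[m + m]}) :
  {in r, forall i, is_symb d (P i) (c i)} -> is_symb d (\sum_(i <- r) P i) (\sum_(i <- r) c i).
Proof. by move=> h; rewrite big_seq [X in is_symb _ _ X]big_seq; apply: is_symb_sum. Qed.

Lemma is_symbD d P Q c q : is_symb d P c -> is_symb d Q q -> is_symb d (P + Q) (c + q).
Proof.
move=> hP hQ s; have [P0 cE] := hP s; have [Q0 qE] := hQ s.
rewrite !mcoeffD cE qE; split=> [ds|]; first by rewrite P0 // Q0 // addr0.
by case: ifP; rewrite ?addr0.
Qed.

Lemma is_symbZ d z P c : is_symb d P c -> is_symb d (z *: P) (z *: c).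
Proof.
move=> hP s; have [P0 cE] := hP s; rewrite !mcoeffZ cE.
by split=> [ds|]; [rewrite P0 // mulr0 | case: ifP; rewrite ?mulr0].
Qed.

Lemma is_symbB d P Q c q : is_symb d P c -> is_symb d Q q -> is_symb d (P - Q) (c - q).
Proof. by move=> hP hQ; rewrite -[- Q]scaleN1r -[- q]scaleN1r; apply/is_symbD/is_symbZ. Qed.

Lemma is_symb_lt d d' P c : is_symb d P c -> (d < d')%N -> is_symb d' P 0.
Proof.
move=> hP lt_d s; have [P0 _] := hP s; rewrite mcoeff0; split.
  by move=> ds; apply: P0; apply: ltn_trans ds.
by case: eqP => // ds; rewrite P0 ?ds.
Qed.

Lemma is_symbX s : is_symb (dorder_mono s) 'X_[s] 'X_[s].
Proof.
move=> t; rewrite mcoeffX; case: (eqVneq s t) => [->|ne]; first by rewrite eqxx ltnn.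
by split=> //; case: ifP.
Qed.

Lemma is_symb_hsum d P c : is_symb d P c ->
  c = \sum_(s <- msupp P) (if dorder_mono s == d then P@_s else 0) *: 'X_[s].
Proof.
move=> hP; apply/mpolyP => t; rewrite mcoeff_sum_supp; have [_ ->] := hP t.
by case: (boolP (t \in msupp P)) => // /memN_msupp_eq0 ->; rewrite if_same.
Qed.

(** Only the Leibniz term with [f] = 0 keeps the full order; each derivative spent on a power of x
    lowers it by one. *)
Lemma is_symb_weyl_mono s t :
  is_symb (dorder_mono s + dorder_mono t) (weyl_mono s t) 'X_[s + t].
Proof.
pose N := (mdeg s).+1.
have ltN i : (s (rshift m i) < N)%N.
  by rewrite ltnS mdegE (bigD1 (rshift m i)) //= leq_addr.
rewrite (weyl_monoE _ s t _ ltN) (bigD1 [ffun=> ord0]) //= -['X_[s + t]]addr0.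
apply: is_symbD.
  rewrite big1 ?scale1r => [|i _]; last by rewrite ffunE bin0 ffactn0.
  have -> : leibniz_mnm m s t (fun i => [ffun=> ord0 : 'I_N] i) = (s + t)%MM.
    apply/mnmP => i; rewrite -(splitK i) mnmDE; case: (split i) => j /=.
      by rewrite leibniz_mnml ffunE subn0.
    by rewrite leibniz_mnmr ffunE subn0.
  by rewrite -dorder_monoD; apply: is_symbX.
have sum0 : 0 = \sum_(f : {ffun 'I_m -> 'I_N} | f != [ffun=> ord0]) (0 : {mpoly CC[m + m]}).
  by rewrite big1.
rewrite [X in is_symb _ _ X]sum0.
apply: is_symb_sum => f f_ne.
case: (boolP [forall i, f i <= s (rshift m i)]%N) => [/forallP le_f|]; last first.
  rewrite negb_forall; case/existsP => i; rewrite -ltnNge => lt_f.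
  rewrite (bigD1 i) //= bin_small // mul0n mul0r scale0r => u.
  by rewrite mcoeff0 if_same.
rewrite -[X in is_symb _ _ X](scaler0 _ (\prod_(i < m) ('C(s (rshift m i), f i) * t (lshift m i) ^_ f i)%:R)).
apply: is_symbZ.
apply: (is_symb_lt _ _ _ _ (is_symbX _)).
have [i fi] : exists i, (0 < f i)%N.
  apply/existsP; apply: contraR f_ne; rewrite negb_exists => /forallP f0.
  apply/eqP/ffunP => i; rewrite ffunE; apply: val_inj => /=.
  by apply/eqP; rewrite -leqn0 leqNgt.
rewrite /dorder_mono -big_split /= (bigD1 i) //= [X in (_ < X)%N](bigD1 i) //= -addSn.
rewrite leq_add //; first by rewrite leibniz_mnmr /=; move: fi (le_f i); case: (f i : nat) => [//|l]; lia.
by apply: leq_sum => j _; rewrite leibniz_mnmr /=; have := le_f j; lia.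
Qed.

Lemma is_symb_weyl_mul d e P Q c q :
  is_symb d P c -> is_symb e Q q -> is_symb (d + e) (weyl_mul P Q) (c * q).
Proof.
move=> hP hQ; rewrite (is_symb_hsum _ _ _ hP) (is_symb_hsum _ _ _ hQ) /weyl_mul mulr_suml.
apply: is_symb_sum_seq => s sP; rewrite mulr_sumr; apply: is_symb_sum_seq => t tQ.
rewrite -scalerAl -scalerAr scalerA -mpolyXD.
have le_s : (dorder_mono s <= d)%N.
  by rewrite leqNgt; apply/negP => /(hP s).1 Ps; rewrite mcoeff_msupp Ps eqxx in sP.
have le_t : (dorder_mono t <= e)%N.
  by rewrite leqNgt; apply/negP => /(hQ t).1 Qt; rewrite mcoeff_msupp Qt eqxx in tQ.
have hst := is_symbZ _ (P@_s * Q@_t) _ _ (is_symb_weyl_mono s t).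
case: eqP => [<-|ne_s].
  case: eqP => [<-|ne_t]; first exact: hst.
  rewrite mulr0 scale0r; apply: is_symb_lt hst _; lia.
rewrite mul0r scale0r; apply: is_symb_lt hst _; lia.
Qed.

Lemma dorder_mono_l i : dorder_mono (U_(lshift m i))%MM = 0%N.
Proof. by rewrite /dorder_mono big1 // => j _; rewrite mnm1E eq_lrshift. Qed.

Lemma dorder_mono_r i : dorder_mono (U_(rshift m i))%MM = 1%N.
Proof.
rewrite /dorder_mono (bigD1 i) //= mnm1E eqxx big1 // => j ji.
by rewrite mnm1E eq_rshift eq_sym (negbTE ji).
Qed.

Lemma is_symb_wx i : is_symb 0 (wx i) 'X_(lshift m i).
Proof. by rewrite -(dorder_mono_l i); apply: is_symbX. Qed.

Lemma is_symb_wd i : is_symb 1 (wd i) 'X_(rshift m i).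
Proof. by rewrite -(dorder_mono_r i); apply: is_symbX. Qed.

Lemma is_symb_euler i :
  is_symb 1 (weyl_mul (wx i) (wd i)) ('X_(lshift m i) * 'X_(rshift m i)).
Proof. exact: is_symb_weyl_mul (is_symb_wx i) (is_symb_wd i). Qed.

Lemma is_symb1 : is_symb 0 1 1.
Proof.
have d0 : dorder_mono (0 : 'X_{1..m + m})%MM = 0%N by rewrite /dorder_mono big1 // => i _; rewrite mnm0E.
by rewrite -mpolyX0 -{1}d0; apply: is_symbX.
Qed.

Lemma is_symb_add_wc P c z : is_symb 1 P c -> is_symb 1 (P + wc m z) c.
Proof.
move=> hP; rewrite -[c]addr0; apply: is_symbD => //.
rewrite /wc -[z%:MP]mulr1 mul_mpolyC -(scaler0 _ z); apply: is_symbZ.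
exact: is_symb_lt is_symb1 _.
Qed.

Lemma is_symb_weyl_prod p (T : 'I_p -> Weyl m) c :
  (forall i, is_symb 1 (T i) c) -> is_symb p (\big[@weyl_mul m/1]_(i < p) T i) (c ^+ p).
Proof.
move=> hT; suff H (r : seq 'I_p) : is_symb (size r) (\big[@weyl_mul m/1]_(i <- r) T i) (c ^+ size r).
  by have := H (index_enum _); rewrite -sum1_size sum_nat_const card_ord muln1.
elim: r => [|i r IH]; first by rewrite big_nil; apply: is_symb1.
by rewrite big_cons /= exprS -[(size r).+1]add1n; apply: is_symb_weyl_mul.
Qed.

Lemma is_symb_ell p (a : 'I_p -> CC) (b : 'I_p -> 'I_m -> CC) k :
  is_symb p (ell a b k) (('X_(lshift m k) * 'X_(rshift m k)) ^+ p
    - 'X_(lshift m k) * (\sum_j 'X_(lshift m j) * 'X_(rshift m j)) ^+ p).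
Proof.
apply: is_symbB.
  by apply: is_symb_weyl_prod => i; apply/is_symb_add_wc/is_symb_euler.
apply: (is_symb_weyl_mul 0 p); first exact: is_symb_wx.
apply: is_symb_weyl_prod => i; apply/is_symb_add_wc.
by apply: is_symb_sum => j _; apply: is_symb_euler.
Qed.

Lemma weyl_mono0 t : weyl_mono 0%MM t = 'X_[t].
Proof.
rewrite (weyl_monoE _ _ _ 1) => [|i]; last by rewrite mnm0E.
rewrite (big_pred1 [ffun=> ord0]) => [|f]; last first.
  by apply/esym/eqP/ffunP => i; rewrite ffunE [f i]ord1.
rewrite big1 ?scale1r => [|i _]; last by rewrite ffunE bin0 ffactn0.
congr 'X_[_]; apply/mnmP => i; rewrite -(splitK i); case: (split i) => j /=.
  by rewrite leibniz_mnml ffunE subn0 mnm0E.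
by rewrite leibniz_mnmr mnm0E.
Qed.

Lemma weyl_mul1 P : weyl_mul 1 P = P.
Proof.
rewrite /weyl_mul msupp1 big_seq1 [RHS]mpolyE; apply: eq_bigr => t _.
by rewrite mcoeff1 eqxx mul1r weyl_mono0.
Qed.

Lemma ell_in_ideal p (a : 'I_p -> CC) (b : 'I_p -> 'I_m -> CC) k : in_ideal a b (ell a b k).
Proof.
exists (fun j => if j == k then 1 else 0); rewrite (bigD1 k) //= eqxx weyl_mul1 big1 ?addr0 // => j.
by move/negbTE->; rewrite /weyl_mul msupp0 big_nil.
Qed.

(** Allows the component of order [d] to vanish, so the exact order of the generators never has to
    be determined. *)
Lemma is_symb_psymb d P c : is_symb d P c -> c = if dorder P == d then psymb P else 0.
Proof.
move=> hP; have le_d : (dorder P <= d)%N.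
  apply/bigmax_leqP_seq => s sP _; rewrite leqNgt; apply/negP => /(hP s).1 Ps.
  by rewrite mcoeff_msupp Ps eqxx in sP.
rewrite (is_symb_hsum _ _ _ hP) /psymb; case: eqP => [<-|ne].
  by rewrite [RHS]big_mkcond; apply: eq_bigr => s _; case: ifP; rewrite ?scale0r.
rewrite big1_seq // => s /andP[_ sP].
have le_s : (dorder_mono s <= dorder P)%N by apply: (leq_bigmax_seq (F := @dorder_mono m)).
by case: eqP => [e|]; rewrite ?scale0r //; case: ne; apply/eqP; rewrite eqn_leq le_d -e.
Qed.

Lemma charvar_ell p (a : 'I_p -> CC) (b : 'I_p -> 'I_m -> CC) v k : charvar a b v ->
  (v (lshift m k) * v (rshift m k)) ^+ p =
  v (lshift m k) * (\sum_j v (lshift m j) * v (rshift m j)) ^+ p.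
Proof.
move=> hv; apply/eqP; rewrite -subr_eq0; apply/eqP.
have := is_symb_psymb _ _ _ (is_symb_ell p a b k) => /(congr1 (meval v)).
rewrite (_ : (if _ then _ else _).@[v] = 0); last first.
  by case: ifP => _; [apply: hv; apply: ell_in_ideal | rewrite meval0].
rewrite mevalB !(rmorphM, rmorphXn) /= raddf_sum /= !mevalXU => h; rewrite -[RHS]h.
rewrite (eq_bigr (fun j => ('X_(lshift m j) * 'X_(rshift m j)).@[v])) // => j _.
by rewrite rmorphM /= !mevalXU.
Qed.

End Symbols.

(** * The polynomial R *)

Lemma Rcos_add (x y : Rdefinitions.R) :
  Rtrigo_def.cos (x + y) = Rtrigo_def.cos x * Rtrigo_def.cos y - Rtrigo_def.sin x * Rtrigo_def.sin y.
Proof. exact: cosD. Qed.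

Lemma Rsin_add (x y : Rdefinitions.R) :
  Rtrigo_def.sin (x + y) = Rtrigo_def.sin x * Rtrigo_def.cos y + Rtrigo_def.cos x * Rtrigo_def.sin y.
Proof. exact: sinD. Qed.

Lemma zetaX p k : zeta p ^+ k =
  Complex (Rtrigo_def.cos (k%:R * (2%:R * Rtrigo1.PI / p%:R)))
          (Rtrigo_def.sin (k%:R * (2%:R * Rtrigo1.PI / p%:R))).
Proof.
rewrite /zeta; move: (_ / p%:R) => x; elim: k => [|k IH].
  by rewrite expr0 mul0r (Rtrigo_def.cos_0 : Rtrigo_def.cos 0 = 1) (Rtrigo_def.sin_0 : Rtrigo_def.sin 0 = 0).
rewrite exprSr IH -[k.+1]addn1 natrD mulrDl mul1r Rsin_add Rcos_add.
by apply/eqP; rewrite eq_complex /= eqxx /= addrC eqxx.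
Qed.

(** Half-angle formula: cos x = 1 - 2 sin(x/2)^2, with x/2 strictly between 0 and PI. *)
Lemma cos_lt1 (x : Rdefinitions.R) : 0 < x -> x < 2%:R * Rtrigo1.PI -> Rtrigo_def.cos x < 1.
Proof.
move=> x0 x2.
have xE : x = 2%:R * (x / 2%:R) by rewrite mulrC divfK ?pnatr_eq0.
have sin_gt0 : 0 < Rtrigo_def.sin (x / 2%:R).
  apply/RltP; apply: Rtrigo1.sin_gt_0; apply/RltP; first by rewrite divr_gt0.
  by rewrite ltr_pdivrMr // mulrC.
rewrite [X in Rtrigo_def.cos X]xE mulr_natl mulr2n Rcos_add.
set y := x / 2%:R.
have sc : Rtrigo_def.sin y * Rtrigo_def.sin y + Rtrigo_def.cos y * Rtrigo_def.cos y = 1.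
  exact: Rtrigo1.sin2_cos2.
by rewrite -{}sc -subr_gt0 opprB addrACA subrr addr0 addr_gt0 ?mulr_gt0.
Qed.

Lemma zeta_prim p : (0 < p)%N -> p.-primitive_root (zeta p).
Proof.
move=> p0.
have PI0 : 0 < Rtrigo1.PI by apply/RltP; apply: Rtrigo1.PI_RGT_0.
have pR : (p%:R : Rdefinitions.R) != 0 by rewrite pnatr_eq0 -lt0n.
apply/andP; split => //; apply/forallP => i; rewrite unity_rootE zetaX; apply/eqP.
case: (eqVneq i.+1 p) => [->|ne_ip].
  rewrite mulrC divfK // mulr_natl mulr2n Rcos_add Rsin_add.
  rewrite (Rtrigo1.cos_PI : _ = - 1) (Rtrigo1.sin_PI : _ = 0).
  by rewrite eq_complex /= !(mulr0, mul0r) subr0 addr0 mulrNN mulr1 !eqxx.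
have lt_ip : (i.+1 < p)%N by rewrite ltn_neqAle ne_ip ltn_ord.
apply/negbTE/eqP => -[cos1 _]; move: (ltxx (1 : Rdefinitions.R)); rewrite -{1}cos1 cos_lt1 //.
  apply: mulr_gt0; rewrite ?ltr0n //; apply: divr_gt0; rewrite ?ltr0n //.
  by apply: mulr_gt0; rewrite ?ltr0n.
rewrite mulrA ltr_pdivrMr ?ltr0n // [X in _ < X]mulrC ltr_pM2r ?ltr_nat //.
by apply: mulr_gt0; rewrite ?ltr0n.
Qed.

Lemma unity_translate p (y z : CC) : (0 < p)%N -> z != 0 -> y ^+ p = z ^+ p ->
  exists j : 'I_p, y = zeta p ^+ j.+1 * z.
Proof.
move=> p0 z0 e; have zp := zeta_prim p p0.
have [i hi] : exists i : 'I_p, y / z = zeta p ^+ i.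
  have /(prim_rootP zp)[i ->] : (y / z) ^+ p = 1 by rewrite expr_div_n e divff // expf_neq0.
  by exists i.
(* Exponents run over 1..p, hence the cyclic predecessor of the exponent found in 0..p-1. *)
exists (ord_pred i); apply: (canRL (divfK z0)); rewrite hi.
by rewrite -[in LHS](ord_predK i) /= (prim_expr_mod zp).
Qed.

(** * Descent of the product from the y_k to the x_k = y_k^p *)

Section DiscriminantPolynomial.
Variables (m p : nat).
Hypothesis p_gt0 : (0 < p)%N.

Definition disc_factor (f : {ffun 'I_m -> 'I_p}) : {mpoly CC[m]} :=
  1 - \sum_k zeta p ^+ (f k).+1 *: 'X_k.

(* R as a polynomial in y_k, where x_k = y_k^p. *)
Definition disc_cover : {mpoly CC[m]} := \prod_f disc_factor f.

(** The deck transformation y_k -> zeta y_k of the covering x = y^p. *)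
Definition scale_var (k : 'I_m) : {mpoly CC[m]} -> {mpoly CC[m]} :=
  mmap (@mpolyC m CC) (fun i => (if i == k then zeta p else 1) *: 'X_i).

Lemma zeta_ordS (i : 'I_p) : zeta p ^+ (ordS i).+1 = zeta p ^+ i.+1 * zeta p.
Proof. by rewrite exprSr /= (prim_expr_mod (zeta_prim p p_gt0)). Qed.

(** The substitution permutes the linear factors by a cyclic shift of the k-th index. *)
Lemma scale_var_cover k : scale_var k disc_cover = disc_cover.
Proof.
pose sh (g : 'I_p -> 'I_p) (f : {ffun 'I_m -> 'I_p}) : {ffun 'I_m -> 'I_p} :=
  [ffun i => if i == k then g (f i) else f i].
have shK g g' : cancel g g' -> cancel (sh g) (sh g').
  by move=> gK f; apply/ffunP => i; rewrite !ffunE; case: eqP.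
rewrite /scale_var rmorph_prod /= /disc_cover [RHS](reindex (sh (@ordS p))) /=; last first.
  by exists (sh (@ord_pred p)) => f _; apply: shK; [apply: ordSK | apply: ord_predK].
apply: eq_bigr => f _; rewrite /disc_factor rmorphB rmorph1 /=; congr (_ - _); rewrite raddf_sum /=.
apply: eq_bigr => i _; rewrite mmapZ mmapX mmap1U mul_mpolyC scalerA /sh ffunE.
by case: eqP => [->|_]; rewrite ?zeta_ordS ?mulr1.
Qed.

Lemma scale_varE k P : scale_var k P = \sum_(s <- msupp P) (P@_s * zeta p ^+ s k) *: 'X_[s].
Proof.
rewrite /scale_var /mmap; apply: eq_bigr => s _.
rewrite /mmap1 mul_mpolyC -scalerA; congr (_ *: _).
rewrite (eq_bigr (fun i => (if i == k then zeta p else 1) ^+ s i *: 'X_i ^+ s i)); last first.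
  by move=> i _; rewrite exprZn.
rewrite scaler_prod -mpolyXE_id (bigD1 k) //= eqxx big1 ?mulr1 // => i /negbTE ->.
exact: expr1n.
Qed.

(** By invariance, zeta^(s_k) = 1 for each monomial that occurs, and zeta is a primitive root. *)
Lemma cover_supp_dvd s k : s \in msupp disc_cover -> (p %| s k)%N.
Proof.
move=> sG; have s_ne := sG; rewrite mcoeff_msupp in s_ne; rewrite (prim_order_dvd (zeta_prim p p_gt0)).
have := congr1 (mcoeff s) (scale_var_cover k).
rewrite scale_varE (mcoeff_sum_supp _ _ _ (fun s => _ * zeta p ^+ s k)) sG.
by move/eqP; rewrite -[X in _ == X]mulr1 (inj_eq (mulfI s_ne)).
Qed.

Definition mnm_div (s : 'X_{1..m}) : 'X_{1..m} := [multinom s k %/ p | k < m]%N.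

Definition disc_poly : {mpoly CC[m]} :=
  \sum_(s <- msupp disc_cover) disc_cover@_s *: 'X_[mnm_div s].

Lemma disc_poly_eval x : disc_poly.@[x] = Rfun p x.
Proof.
transitivity (disc_cover.@[fun k => p.-root (x k)]).
  rewrite [RHS]mevalE raddf_sum /=; apply: eq_big_seq => s sG.
  rewrite mevalZ mevalX; congr (_ * _); apply: eq_bigr => k _.
  by rewrite mnmE -{2}(divnK (cover_supp_dvd s k sG)) mulnC exprM rootCK.
rewrite rmorph_prod; apply: eq_bigr => f _.
rewrite /= /disc_factor mevalB meval1; congr (_ - _); rewrite raddf_sum; apply: eq_bigr => k _.
by rewrite /= mevalZ mevalXU.
Qed.

Lemma mnm_div_deg s : s \in msupp disc_cover -> (mdeg (mnm_div s) * p = mdeg s)%N.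
Proof.
move=> sG; rewrite !mdegE big_distrl /=; apply: eq_bigr => k _.
by rewrite mnmE divnK // cover_supp_dvd.
Qed.

(** Ensures that no coefficients cancel in [disc_poly]. *)
Lemma mnm_div_inj : {in msupp disc_cover &, injective mnm_div}.
Proof.
move=> s t sG tG e; apply/mnmP => k.
by rewrite -(divnK (cover_supp_dvd s k sG)) -(divnK (cover_supp_dvd t k tG));
  have /mnmP/(_ k) := e; rewrite !mnmE => ->.
Qed.

Lemma disc_poly_coef s : s \in msupp disc_cover -> disc_poly@_(mnm_div s) = disc_cover@_s.
Proof.
move=> sG; rewrite raddf_sum /= (bigD1_seq s) ?msupp_uniq //= mcoeffZ mcoeffX eqxx mulr1.
rewrite big1_seq ?addr0 // => t /andP[ne_ts tG]; rewrite mcoeffZ mcoeffX.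
case: eqP => [e|_]; last by rewrite mulr0.
by case/eqP: ne_ts; apply: mnm_div_inj.
Qed.

Lemma disc_factor_size f : (0 < m)%N -> msize (disc_factor f) = 2%N.
Proof.
move=> m0; pose k := Ordinal m0; apply/eqP; rewrite eqn_leq; apply/andP; split.
  apply: leq_trans (msizeD_le _ _) _; rewrite msize1 geq_max /= msizeN.
  apply: leq_trans (msize_sum _ _ _) _; apply/bigmax_leqP => i _.
  by apply: leq_trans (msizeZ_le _ _) _; rewrite msizeX mdeg1.
rewrite -[2%N]/(1.+1) -(mdeg1 k); apply: msize_mdeg_lt; rewrite mcoeff_msupp.
rewrite mcoeffB mcoeff1 mnm1_eq0 sub0r oppr_eq0 raddf_sum /= (bigD1 k) //=.
rewrite mcoeffZ mcoeffXU eqxx mulr1 big1 ?addr0.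
  by rewrite expf_neq0 // (prim_root_eq0 (zeta_prim p p_gt0)) -lt0n.
by move=> i ik; rewrite mcoeffZ mcoeffXU (negbTE ik) mulr0.
Qed.

Lemma disc_cover_size : (0 < m)%N -> msize disc_cover = (p ^ m).+1.
Proof.
move=> m0; suff H (r : seq {ffun 'I_m -> 'I_p}) : msize (\prod_(f <- r) disc_factor f) = (size r).+1.
  rewrite /disc_cover H; congr _.+1.
  by rewrite -sum1_size sum_nat_const muln1 card_ffun !card_ord.
elim: r => [|f r IH]; first by rewrite big_nil msize1.
by rewrite big_cons msizeM -?msize_poly_eq0 ?IH ?disc_factor_size.
Qed.

(** The cover is a product of p^m factors of degree 1, and dividing all exponents by p divides the
    degree by p. *)
Lemma disc_poly_size : (0 < m)%N -> (msize disc_poly).-1 = (p ^ m.-1)%N.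
Proof.
move=> m0; have pm : (p ^ m = p ^ m.-1 * p)%N by rewrite -expnSr prednK.
have G0 : disc_cover != 0 by rewrite -msize_poly_eq0 disc_cover_size.
have sG := mlead_supp G0; set s := mlead _ in sG.
have ds : mdeg (mnm_div s) = (p ^ m.-1)%N.
  apply/eqP; rewrite -(eqn_pmul2r p_gt0) mnm_div_deg // -pm.
  by rewrite -eqSS mlead_deg // disc_cover_size.
apply/eqP; rewrite eqn_leq; apply/andP; split; last first.
  rewrite -ds -ltnS; apply: leq_trans (leqSpred _); apply: msize_mdeg_lt.
  by rewrite mcoeff_msupp disc_poly_coef // -mcoeff_msupp.
case sz : (msize disc_poly) => [//|l] /=.
have D0 : disc_poly != 0 by rewrite -msize_poly_eq0 sz.
have := mlead_supp D0; set t := mlead _ => tD.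
have dt : mdeg t = l by apply/eqP; rewrite -eqSS mlead_deg // sz.
have [u uG /eqP tu] : exists2 u, u \in msupp disc_cover & t == mnm_div u.
  apply/hasP; apply: contraLR tD; rewrite -all_predC => /allP h.
  rewrite mcoeff_msupp negbK raddf_sum /= big1_seq // => u /andP[_ uG].
  by rewrite mcoeffZ mcoeffX eq_sym (negbTE (h u uG)) mulr0.
rewrite -(leq_pmul2r p_gt0) -dt tu mnm_div_deg // -pm -ltnS -disc_cover_size //.
exact: msize_mdeg_lt.
Qed.

End DiscriminantPolynomial.

(** * The singular locus *)

Section SingularPoints.
Variables (m p : nat) (a : 'I_p -> CC) (b : 'I_p -> 'I_m -> CC).
Hypothesis p_gt0 : (0 < p)%N.

Lemma proj_charvar_sub x : proj_charvar a b x -> (\prod_(k < m) x k) * Rfun p x = 0.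
Proof.
move=> [v [hv [i0 xi_ne] xv]].
case: (boolP [exists k, x k == 0]) => [|/existsPn x_ne].
  by case/existsP => k /eqP xk; rewrite (bigD1 k) //= xk !mul0r.
pose S := \sum_j v (lshift m j) * v (rshift m j).
have e k : (x k * v (rshift m k)) ^+ p = x k * S ^+ p.
  by rewrite xv (charvar_ell _ _ _ _ _ _ hv).
(* If S = 0, the equations force x_k xi_k = 0 for all k, against x_k and some xi_k being nonzero. *)
have S_ne : S != 0.
  apply/eqP => S0; have := e i0; rewrite S0 expr0n -[p == _]negbK -lt0n p_gt0 mulr0 => /eqP.
  by rewrite expf_eq0 p_gt0 mulf_eq0 (negbTE (x_ne i0)) (negbTE xi_ne).
have root_ex k : exists j : 'I_p, x k * v (rshift m k) / S = zeta p ^+ j.+1 * p.-root (x k).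
  apply: unity_translate => //; first by rewrite rootC_eq0.
  by rewrite expr_div_n e rootCK // mulfK // expf_neq0.
have [f hf] := fin_all_exists root_ex.
(* The factor indexed by [f] vanishes: the quotients w_k / S add up to 1. *)
rewrite /Rfun [X in _ * X](bigD1 [ffun k => f k]) //= [X in _ * (X * _)](_ : _ = 0) ?mul0r ?mulr0 //.
apply/eqP; rewrite subr_eq0; apply/eqP.
rewrite (eq_bigr (fun k => v (lshift m k) * v (rshift m k) / S)) => [|k _].
  by rewrite -mulr_suml divff.
by rewrite ffunE -hf xv.
Qed.

Hypothesis b_ne : forall i k (l : nat), b i k + l%:R != 0.
Hypothesis b_one : forall k, exists i, b i k = 1.
Hypothesis a_ne : forall i (l : nat), a i + l%:R != 0.

Definition point (x xi : 'I_m -> CC) (i : 'I_(m + m)) : CC :=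
  match split i with inl k => x k | inr k => xi k end.

Lemma point_l x xi k : point x xi (lshift m k) = x k.
Proof. by rewrite /point -[lshift m k]/(unsplit (inl k)) unsplitK. Qed.

Lemma point_r x xi k : point x xi (rshift m k) = xi k.
Proof. by rewrite /point -[rshift m k]/(unsplit (inr k)) unsplitK. Qed.

Lemma sub_proj_charvar x : (\prod_(k < m) x k) * Rfun p x = 0 -> proj_charvar a b x.
Proof.
case: (boolP [exists k, x k == 0]) => [|/existsPn x_ne].
  case/existsP => k /eqP xk _; exists (point x (fun i => (i == k)%:R)); split.
  - by apply: (charvar_hyperplane _ _ _ _ b_ne b_one k) => [|i]; rewrite ?point_l ?point_r.
  - by exists k; rewrite point_r eqxx oner_neq0.
  - by move=> i; rewrite point_l.
move/eqP; rewrite mulf_eq0 prodf_seq_eq0 => /orP[/hasP[k _ /= xk]|].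
  by have := x_ne k; rewrite xk.
rewrite prodf_seq_eq0 => /hasP[f _ /=]; rewrite subr_eq0 => /eqP w1.
(* The vanishing factor gives w_k^p = x_k with sum 1, so xi_k = w_k / x_k satisfies the symbol
   equations with S = 1. *)
pose w k := zeta p ^+ (f k).+1 * p.-root (x k).
have wx k : x k * (w k / x k) = w k by rewrite mulrC divfK.
have sw : \sum_k point x (fun k => w k / x k) (lshift m k) * point x (fun k => w k / x k) (rshift m k) = 1.
  by rewrite w1; apply: eq_bigr => k _; rewrite point_l point_r wx.
have w_ne k : w k != 0.
  rewrite /w mulf_neq0 ?rootC_eq0 // expf_neq0 //.
  by rewrite (prim_root_eq0 (zeta_prim p p_gt0)) -lt0n.
exists (point x (fun k => w k / x k)); split; last by move=> i; rewrite point_l.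
  apply: (charvar_generic _ _ _ _ b_ne b_one a_ne) => [k||k]; rewrite ?sw ?oner_neq0 ?point_l //.
  rewrite point_r wx /w exprMn rootCK // exprAC expr1n mulr1.
  by rewrite (prim_expr_order (zeta_prim p p_gt0)) expr1n mul1r.
(* An empty sum could not equal 1, so there is an index at which xi is nonzero. *)
have [i _] : exists i : 'I_m, True.
  case: (pickP (fun _ : 'I_m => true)) => [i _|no]; first by exists i.
  by move/eqP: w1; rewrite big_pred0 // oner_eq0.
by exists i; rewrite point_r mulf_neq0 ?invr_eq0.
Qed.

End SingularPoints.

Theorem mainTheorem6 (m p : nat) (a : 'I_p -> CC) (b : 'I_p -> 'I_m -> CC) :
  (0 < p)%N ->
  (* b_{p,k} = 1 *)
  (forall (j : 'I_p) (k : 'I_m), val j = p.-1 -> b j k = 1) ->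
  (* b_{j,k} not in {0,-1,-2,...} for 1 <= j <= p-1 *)
  (forall (j : 'I_p) (k : 'I_m), (val j < p.-1)%N ->
      forall n : nat, b j k <> - (n%:R)) ->
  (* (C1) *)
  (forall (i : 'I_p) (js : {ffun 'I_m -> 'I_p}),
      ~ isInt (a i - \sum_(k < m) b (js k) k)) ->
  (* (C2) *)
  (forall (k : 'I_m) (j j' : 'I_p), (val j < val j')%N ->
      ~ isInt (b j k - b j' k)) ->
  (forall x : 'I_m -> CC,
      sing_locus a b x <-> (\prod_(k < m) x k) * Rfun p x = 0)
  /\ ((0 < m)%N ->
      exists Rp : {mpoly CC[m]},
        (msize Rp).-1 = (p ^ m.-1)%N /\ forall x, Rp.@[x] = Rfun p x).
Proof.
move=> p0 b1 b_gen c1 _.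
have lt_last : (p.-1 < p)%N by rewrite prednK.
pose last := Ordinal lt_last.
have b_one k : exists i, b i k = 1 by exists last; apply: b1.
have b_ne i k (l : nat) : b i k + l%:R != 0.
  have [lt_i|ge_i] := ltnP i p.-1; first by rewrite addr_eq0; apply/eqP/b_gen.
  rewrite (b1 i k) -?natr1 ?[1 + _]addrC ?natr1 ?pnatr_eq0 //.
  by apply/eqP; rewrite eqn_leq ge_i -ltnS prednK ?ltn_ord.
have a_ne i (l : nat) : a i + l%:R != 0.
  (* With every chosen b equal to 1, (C1) says that a_i - m is not an integer; a_i = -l would make
     it -(l + m). *)
  apply/eqP => al; apply: (c1 i [ffun=> last]); exists (- (l + m)%N%:Z).
  rewrite (eq_bigr (fun=> 1)) => [|k _]; last by rewrite ffunE b1.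
  rewrite sumr_const card_ord rmorphN /= -pmulrn natrD opprD; congr (_ - _).
  by apply/eqP; rewrite -addr_eq0 al.
split; last first.
  move=> m0; exists (disc_poly m p); split; first exact: disc_poly_size.
  by move=> x; apply: disc_poly_eval.
(* The projection is already the zero set of a polynomial, so taking the Zariski closure adds
   nothing. *)
move=> x; split=> [hx|hx]; last by move=> f; apply; apply: (sub_proj_charvar _ _ _ _ p0 b_ne).
have ev y : (\prod_(k < m) 'X_k * disc_poly m p).@[y] = (\prod_(k < m) y k) * Rfun p y.
  rewrite mevalM disc_poly_eval // rmorph_prod /=; congr (_ * _).
  by apply: eq_bigr => k _; rewrite mevalXU.
by rewrite -ev; apply: hx => y hy; rewrite ev; apply: proj_charvar_sub hy.
Qed.
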